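(* Suppose $f=\frac1n\sum_{i=1}^n f_i$ is $\mu$-strongly convex and each $f_i$ has $L$-Lipschitz continuous gradient; let $\kappa=\frac L\mu$ and $n_c\ge1$. Let $\mathbf{W}$ be a mixing matrix with $\mathbf{W}\ne\frac{1_n1_n^T}{n}$. If $0<\alpha\le\frac1L$, then the spectral radii of the matrices $A_1(n_c),A_2(n_c),A_3(n_c)$ (for GTA-1, GTA-2, GTA-3 with $n_g=1$; see context) satisfy $$\rho(A_1(n_c))\le\max\left\{1-\frac{\alpha\mu}{2},\ \beta^{n_c}+\sqrt{\alpha L}\left(2.5+\sqrt{2\kappa}\right)\right\},$$ $$\rho(A_2(n_c))\le\max\left\{1-\frac{\alpha\mu}{2},\ \beta^{n_c}+\sqrt{\alpha L}\left(2.5+\sqrt{2\kappa\beta^{n_c}}\right)\right\},$$ $$\rho(A_3(n_c))\le\max\left\{1-\frac{\alpha\mu}{2},\ \beta^{n_c}\left(1+\sqrt{\alpha L}\left(2.5+\sqrt{2\kappa}\right)\right)\right\}.$$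
   Context: $f_i:\mathbb{R}^d\to\mathbb{R}$, $i=1,\dots,n$, are differentiable. $\mu$-strong convexity ($\mu>0$): $f(z')\ge f(z)+\langle\nabla f(z),z'-z\rangle+\frac{\mu}{2}\|z'-z\|_2^2$ for all $z,z'$. $L$-Lipschitz gradients: $\|\nabla f_i(z)-\nabla f_i(z')\|_2\le L\|z-z'\|_2$ for all $z,z'$ and all $i$. $\rho(\cdot)$ denotes spectral radius. The $n$ nodes form a connected undirected network with edge set $\mathcal{E}$. A mixing matrix $\mathbf{W}\in\mathbb{R}^{n\times n}$ is a symmetric doubly stochastic matrix with $w_{ii}>0$ and, for $i\ne j$, $w_{ij}>0$ if and only if $(i,j)\in\mathcal{E}$ (and $w_{ij}=0$ otherwise); $\beta=\|\mathbf{W}-\frac{1_n1_n^T}{n}\|_2\in[0,1)$. The matrices govern the errors of the iterations $\mathbf{x}_{k+1}=\mathbf{Z}_1^{n_c}\mathbf{x}_k-\alpha\mathbf{Z}_2^{n_c}\mathbf{y}_k$, $\mathbf{y}_{k+1}=\mathbf{Z}_3^{n_c}\mathbf{y}_k+\mathbf{Z}_4^{n_c}(\nabla\mathbf{f}(\mathbf{x}_{k+1})-\nabla\mathbf{f}(\mathbf{x}_k))$ with $\mathbf{Z}_i=\mathbf{W}_i\otimes I_d$, $\nabla\mathbf{f}(\mathbf{x})=(\nabla f_1(x_1),\dots,\nabla f_n(x_n))$, and $(\mathbf{W}_1,\mathbf{W}_2,\mathbf{W}_3,\mathbf{W}_4)=(\mathbf{W},I_n,\mathbf{W},I_n)$ for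 GTA-1, $(\mathbf{W},\mathbf{W},\mathbf{W},I_n)$ for GTA-2, $(\mathbf{W},\mathbf{W},\mathbf{W},\mathbf{W})$ for GTA-3. They are $$A_1(n_c)=\begin{bmatrix}1-\alpha\mu&\frac{\alpha L}{\sqrt n}&0\\0&\beta^{n_c}&\alpha\\ \sqrt n\alpha L^2&L(2+\alpha L)&\beta^{n_c}+\alpha L\end{bmatrix},\quad A_2(n_c)=\begin{bmatrix}1-\alpha\mu&\frac{\alpha L}{\sqrt n}&0\\0&\beta^{n_c}&\alpha\beta^{n_c}\\ \sqrt n\alpha L^2&L(2+\alpha L)&\beta^{n_c}+\alpha L\end{bmatrix},$$ $$A_3(n_c)=\begin{bmatrix}1-\alpha\mu&\frac{\alpha L}{\sqrt n}&0\\0&\beta^{n_c}&\alpha\beta^{n_c}\\ \beta^{n_c}\sqrt n\alpha L^2&\beta^{n_c}L(2+\alpha L)&\beta^{n_c}(1+\alpha L)\end{bmatrix}.$$ *)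

(* Defs.v *)
From HB Require Import structures.
From mathcomp Require Import all_boot all_order all_algebra.
From mathcomp Require Import all_classical all_reals all_analysis.
From mathcomp Require Import complex.

Set Implicit Arguments.
Unset Strict Implicit.
Unset Printing Implicit Defensive.

Import Order.TTheory GRing.Theory Num.Theory.
Import numFieldNormedType.Exports.

Local Open Scope classical_set_scope.
Local Open Scope ring_scope.

Definition dotp (R : realType) (d : nat) (u v : 'cV[R]_d) : R :=
  \sum_(i < d) u i 0 * v i 0.

(* The library norm `|u| on 'cV[R]_d is the sup norm, hence a separate
   Euclidean norm. Both induce the same topology, so the library's
   differentiability is the usual one. *)
Definition norm2 (R : realType) (d : nat) (u : 'cV[R]_d) : R :=
  Num.sqrt (dotp u u).

Definition opnorm2 (R : realType) (m n : nat) (A : 'M[R]_(m, n)) : R :=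
  sup [set norm2 (A *m u) | u in [set u : 'cV[R]_n | norm2 u <= 1]].

(* For n > 0 this is a maximum: the set is finite and, R[i] being algebraically
   closed, nonempty. *)
Definition spectral_radius (R : realType) (n : nat) (A : 'M[R]_n) : R :=
  sup [set ComplexField.Normc.normc l | l in
        [set l : R[i] | eigenvalue (map_mx (real_complex R) A) l]].

Definition grad (R : realType) (d : nat) (f : 'cV[R]_d -> R) (z : 'cV[R]_d) :
    'cV[R]_d :=
  \col_(i < d) 'D_(delta_mx i 0) f z.

Definition strongly_convex (R : realType) (d : nat) (mu : R)
    (f : 'cV[R]_d -> R) : Prop :=
  forall z z' : 'cV[R]_d,
    f z' >= f z + dotp (grad f z) (z' - z) + mu / 2 * norm2 (z' - z) ^+ 2.

Definition lipschitz_gradient (R : realType) (d : nat) (L : R)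
    (f : 'cV[R]_d -> R) : Prop :=
  forall z z' : 'cV[R]_d, norm2 (grad f z - grad f z') <= L * norm2 (z - z').

Definition average (R : realType) (d n : nat) (f : 'I_n -> 'cV[R]_d -> R)
    (z : 'cV[R]_d) : R :=
  n%:R^-1 * \sum_(i < n) f i z.

Definition connected_network (n : nat) (E : rel 'I_n) : Prop :=
  [/\ symmetric E, irreflexive E & forall i j, connect E i j].

Definition doubly_stochastic (R : realType) (n : nat) (W : 'M[R]_n) : Prop :=
  [/\ forall i j, 0 <= W i j,
      forall i, \sum_(j < n) W i j = 1
    & forall j, \sum_(i < n) W i j = 1].

Definition mixing_matrix (R : realType) (n : nat) (E : rel 'I_n)
    (W : 'M[R]_n) : Prop :=
  [/\ W^T = W,
      doubly_stochastic W,
      forall i, 0 < W i i,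
      forall i j, i != j -> (0 < W i j <-> E i j)
    & forall i j, i != j -> ~~ E i j -> W i j = 0].

(* The matrix 1 1^T / n. *)
Definition averaging_mx (R : realType) (n : nat) : 'M[R]_n :=
  const_mx n%:R^-1.

Definition mixing_rate (R : realType) (n : nat) (W : 'M[R]_n) : R :=
  opnorm2 (W - averaging_mx R n).

Definition mx_of_rows (R : realType) (m n : nat) (s : seq (seq R)) :
    'M[R]_(m, n) :=
  \matrix_(i < m, j < n) nth 0 (nth [::] s i) j.

(* A1, A2, A3 bound the error recursions of GTA-1, GTA-2, GTA-3, i.e. of
     x_(k+1) = Z1^nc x_k - alpha Z2^nc y_k,
     y_(k+1) = Z3^nc y_k + Z4^nc (grad f (x_(k+1)) - grad f (x_k))
   with (W1, W2, W3, W4) = (W, I, W, I), (W, W, W, I), (W, W, W, W)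
   respectively, where Zi = Wi (x) I_d. *)
Definition A1 (R : realType) (n nc : nat) (alpha L mu beta : R) : 'M[R]_3 :=
  mx_of_rows 3 3
    [:: [:: 1 - alpha * mu; alpha * L / Num.sqrt n%:R; 0];
        [:: 0; beta ^+ nc; alpha];
        [:: Num.sqrt n%:R * alpha * L ^+ 2; L * (2 + alpha * L);
            beta ^+ nc + alpha * L]].

Definition A2 (R : realType) (n nc : nat) (alpha L mu beta : R) : 'M[R]_3 :=
  mx_of_rows 3 3
    [:: [:: 1 - alpha * mu; alpha * L / Num.sqrt n%:R; 0];
        [:: 0; beta ^+ nc; alpha * beta ^+ nc];
        [:: Num.sqrt n%:R * alpha * L ^+ 2; L * (2 + alpha * L);
            beta ^+ nc + alpha * L]].

Definition A3 (R : realType) (n nc : nat) (alpha L mu beta : R) : 'M[R]_3 :=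
  mx_of_rows 3 3
    [:: [:: 1 - alpha * mu; alpha * L / Num.sqrt n%:R; 0];
        [:: 0; beta ^+ nc; alpha * beta ^+ nc];
        [:: beta ^+ nc * Num.sqrt n%:R * alpha * L ^+ 2;
            beta ^+ nc * L * (2 + alpha * L);
            beta ^+ nc * (1 + alpha * L)]].

(* Main.v *)
Require Import Defs.
From HB Require Import structures.
From mathcomp Require Import all_boot all_order all_algebra.
From mathcomp Require Import all_classical all_reals all_analysis.
From mathcomp Require Import complex.
From mathcomp Require Import ring lra.

(** Each of the three matrices has the form
      [1 - m, u, 0; 0, b, v; x, y, b + e p],
    where p = alpha L, m = alpha mu, b = beta^nc, u v x = e' p^3 and
    v y = e' p (2 + p), with (e, e') equal to (1, 1), (1, b) and (b, b^2)
    respectively; in all three cases e' <= e^2 because 0 <= b <= 1. The three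
    bounds are the single bound
      max (1 - m / 2) (b + s (5/2 e + h)),  s = sqrt p,  h = sqrt (2 kappa e'),
    for these values of e and e' ([spectral_radius_error_mx_le]).

    This bound combines two facts. First, a nonnegative matrix dominates the
    moduli of its complex eigenvectors: if z A = l z then |l| |z| <= |z| A
    entrywise ([eigenvalue_normc_row]). For the above pattern, going once
    around the cycle of the three inequalities shows that r = |l| cannot lie
    beyond the diagonal entries and make the characteristic polynomial
      (r - (1 - m)) ((r - b) (r - b - e p) - v y) - u v x
    positive ([spectral_radius_cyclic_le]). Secondly, this polynomial is
    positive above the bound ([cubic_separation]): there the first factor
    exceeds m / 2 and the second one exceeds p h^2, and m p h^2 / 2 = p^2 e'
    is at least p^3 e'.

    The data of the optimization problem give the signs that are used. Testing
    strong convexity and the Lipschitz condition along a coordinate vector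
    yields mu <= L, hence m <= p <= 1 and 1 - m >= 0
    ([strong_convexity_le_lipschitz]). As W averages the deviations of a vector
    from its mean, it does not increase their quadratic mean, whence beta <= 1
    ([mixing_rate_le1]). *)

Set Implicit Arguments.
Unset Strict Implicit.
Unset Printing Implicit Defensive.

Import Order.TTheory GRing.Theory Num.Theory.
Import numFieldNormedType.Exports.

Local Open Scope ring_scope.

(** * Eigenvalues of nonnegative matrices *)

(** The elementary half of Perron-Frobenius theory: take the moduli of an
    eigenvector and apply the triangle inequality. It replaces every question
    about complex roots by real inequalities. *)
Lemma eigenvalue_normc_row (R : realType) (n : nat) (A : 'M[R]_n) (l : R[i]) :
  (forall i j, 0 <= A i j) -> eigenvalue (map_mx (real_complex R) A) l ->
  exists z : 'rV[R]_n, [/\ z != 0, forall j, 0 <= z 0 j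
    & forall j, ComplexField.Normc.normc l * z 0 j <= (z *m A) 0 j].
Proof.
move=> A0 /eigenvalueP[w wA w0].
exists (map_mx (@ComplexField.Normc.normc R) w); split.
- apply: contraNneq w0 => /rowP z0; apply/eqP/rowP => j.
  by have := z0 j; rewrite !mxE => /ComplexField.Normc.eq0_normc.
- by move=> j; rewrite mxE; case: (w 0 j) => *; exact: sqrtr_ge0.
- move=> j; rewrite mxE -ComplexField.Normc.normcM.
  have /rowP/(_ j) := wA; rewrite !mxE => <-.
  rewrite -lecR.
  rewrite (_ : (ComplexField.Normc.normc _)%:C%C =
    `|\sum_k w 0 k * map_mx (real_complex R) A k j|) //.
  apply: le_trans (ler_norm_sum _ _ _) _; rewrite rmorph_sum /=.
  apply: ler_sum => k _.
  by rewrite !mxE normrM rmorphM /= [`|(A k j)%:C%C|]ger0_norm ?ler0c.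
Qed.

(** The strict inequality in the hypothesis is the positivity of the
    characteristic polynomial at r. If p, q, s are the moduli of the entries of
    an eigenvector, then (r - c) s <= v q, (r - b) q <= u p + y s and
    (r - a) p <= x s; eliminating p and q leaves s times that polynomial
    bounded by 0, so s = 0, and then p = q = 0. *)
Lemma spectral_radius_cyclic_le (R : realType) (a b c u v x y M : R) :
  0 <= a -> 0 <= b -> 0 <= c -> 0 <= u -> 0 <= v -> 0 <= x -> 0 <= y ->
  0 <= M ->
  (forall r, M < r ->
     [/\ a < r, b < r & u * v * x < (r - a) * ((r - b) * (r - c) - v * y)]) ->
  spectral_radius
    (mx_of_rows 3 3 [:: [:: a; u; 0]; [:: 0; b; v]; [:: x; y; c]]) <= M.
Proof.
move=> a0 b0 c0 u0 v0 x0 y0 M0 HM; set A := mx_of_rows _ _ _.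
rewrite /spectral_radius; set S := (X in sup X).
(* The supremum of the empty set is 0. *)
have [S0|/set0P/negP/negPn/eqP->] := pselect (S !=set0)%classic; last first.
  by rewrite sup0.
apply: ge_sup => // _ [l /= el <-]; rewrite leNgt; apply/negP => /HM.
have A0 i j : 0 <= A i j.
  rewrite mxE; by case: i j => [[|[|[|//]]] ?] [[|[|[|//]]] ?].
have [z [z0 zge0 zA]] := eigenvalue_normc_row A0 el.
move: (ComplexField.Normc.normc l : R) zA => r zA [ar br rM].
pose i1 : 'I_3 := lift ord0 ord0; pose i2 : 'I_3 := lift ord0 (lift ord0 ord0).
have := zA ord0; have := zA i1; have := zA i2.
have := zge0 ord0; have := zge0 i1; have := zge0 i2.
have : z 0 ord0 = 0 -> z 0 i1 = 0 -> z 0 i2 = 0 -> False.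
  move=> h0 h1 h2; move/eqP: z0; apply; apply/rowP => j; rewrite mxE.
  case: j => [[|[|[|//]]] ?];
    [rewrite -[RHS]h0|rewrite -[RHS]h1|rewrite -[RHS]h2];
    by congr (z _ _); apply: val_inj.
rewrite !mxE !big_ord_recl !big_ord0 !mxE /= -/i1 -/i2 !mulr0 !addr0 !add0r.
move: (z 0 ord0) (z 0 i1) (z 0 i2) => p q s Hz s0 q0 p0 H2 H1 H0.
have r_a : 0 < r - a by lra.
have r_b : 0 < r - b by lra.
(* The multipliers are chosen so that p and q cancel in the sum of the three
   inequalities. *)
have vq : 0 <= (r - a) * (r - b) * (q * v + s * c - r * s).
  by rewrite !mulr_ge0 ?subr_ge0 // ltW.
have up : 0 <= (r - a) * v * (p * u + (q * b + s * y) - r * q).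
  by rewrite !mulr_ge0 ?subr_ge0 // ltW.
have xs : 0 <= u * v * (p * a + s * x - r * p).
  by rewrite !mulr_ge0 ?subr_ge0.
have s_eq0 : s = 0.
  apply/eqP; rewrite eq_le s0 andbT leNgt; apply/negP => s_gt0.
  have : 0 < s * ((r - a) * ((r - b) * (r - c) - v * y) - u * v * x).
    by rewrite mulr_gt0 // subr_gt0.
  lra.
have p_eq0 : p = 0.
  apply/eqP; rewrite eq_le p0 andbT -(pmulr_rle0 _ r_a).
  by move: H0; rewrite s_eq0; lra.
have q_eq0 : q = 0.
  apply/eqP; rewrite eq_le q0 andbT -(pmulr_rle0 _ r_b).
  by move: H1; rewrite s_eq0 p_eq0; lra.
exact: Hz.
Qed.

(** * The mixing rate lies between 0 and 1 *)

(** Jensen's inequality for the square: the variance of g under the weights w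
    is nonnegative. *)
Lemma sqr_wsum_le (R : realFieldType) (I : finType) (w g : I -> R) :
  (forall i, 0 <= w i) -> \sum_i w i = 1 ->
  (\sum_i w i * g i) ^+ 2 <= \sum_i w i * g i ^+ 2.
Proof.
move=> w0 w1; set e := \sum_i w i * g i.
have : 0 <= \sum_i w i * (g i - e) ^+ 2.
  by apply: sumr_ge0 => i _; rewrite mulr_ge0 ?sqr_ge0.
rewrite (eq_bigr (fun i => w i * g i ^+ 2 - 2 * e * (w i * g i) + e ^+ 2 * w i));
  last by move=> i _; ring.
by rewrite big_split sumrB /= -!mulr_sumr w1 -/e; lra.
Qed.

(** If m is the mean of u, the i-th entry of (W - 1 1^T / n) u is the average of
    the u_j - m under the weights W i j, since row i sums to 1. Jensen's
    inequality and the column sums bound its Euclidean norm by that of u - m,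
    which is at most that of u. *)
Lemma norm2_deviation_le (R : realType) (n : nat) (W : 'M[R]_n) (u : 'cV[R]_n) :
  doubly_stochastic W -> norm2 ((W - averaging_mx R n) *m u) <= norm2 u.
Proof.
move=> [W0 Wr Wc]; apply: ler_wsqrtr; rewrite /dotp.
pose m := n%:R^-1 * \sum_j u j 0.
have nm : n%:R * m = \sum_j u j 0.
  rewrite /m; case: n {W W0 Wr Wc} u @m => [|n] u.
    by rewrite big_ord0 mul0r.
  by rewrite mulrA divff ?mul1r // pnatr_eq0.
have dev i : ((W - averaging_mx R n) *m u) i 0 = \sum_j W i j * (u j 0 - m).
  under [RHS]eq_bigr do rewrite mulrBr.
  rewrite mxE sumrB -mulr_suml Wr mul1r /m mulr_sumr -sumrB.
  by apply: eq_bigr => j _; rewrite !mxE mulrBl.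
apply: (@le_trans _ _ (\sum_i \sum_j W i j * (u j 0 - m) ^+ 2)).
  by apply: ler_sum => i _; rewrite dev -expr2; apply: sqr_wsum_le.
rewrite exchange_big /=; under eq_bigr do rewrite -mulr_suml Wc mul1r.
rewrite (eq_bigr (fun j => u j 0 * u j 0 - 2 * m * u j 0 + m ^+ 2));
  last by move=> j _; ring.
rewrite big_split sumrB /= -mulr_sumr -nm sumr_const card_ord -mulr_natr.
by have := mulr_ge0 (ler0n R n) (sqr_ge0 m); lra.
Qed.

Lemma norm2_0 (R : realType) (d : nat) : norm2 (0 : 'cV[R]_d) = 0.
Proof. by rewrite /norm2 /dotp big1 ?sqrtr0 // => i _; rewrite mxE mul0r. Qed.

Lemma opnorm2_ge0 (R : realType) (m n : nat) (A : 'M[R]_(m, n)) :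
  0 <= opnorm2 A.
Proof.
rewrite /opnorm2; set S := (X in sup X).
have S0 : S 0 by exists 0; rewrite /= ?mulmx0 norm2_0.
(* The supremum of an unbounded set is 0. *)
have [bS|nbS] := pselect (has_ubound S); first exact: ub_le_sup.
by rewrite sup_out // => -[].
Qed.

Lemma mixing_rate_le1 (R : realType) (n : nat) (W : 'M[R]_n) :
  doubly_stochastic W -> mixing_rate W <= 1.
Proof.
move=> dW; apply: ge_sup => [|_ [u /= u1 <-]]; last first.
  exact: le_trans (norm2_deviation_le _ _) u1.
by exists (norm2 ((W - averaging_mx R n) *m 0)), 0; rewrite //= norm2_0.
Qed.

(** * Strong convexity against Lipschitz gradients *)

Lemma ler_entry_norm2 (R : realType) (d : nat) (u : 'cV[R]_d) (i : 'I_d) :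
  u i 0 <= norm2 u.
Proof.
apply: le_trans (ler_norm _) _; rewrite -sqrtr_sqr; apply: ler_wsqrtr.
rewrite /dotp (bigD1 i) //= -expr2 lerDl.
by apply: sumr_ge0 => j _; rewrite -expr2 sqr_ge0.
Qed.

Lemma grad_average (R : realType) (d n : nat) (f : 'I_n -> 'cV[R]_d -> R)
    (z : 'cV[R]_d) :
  (forall i, differentiable (f i) z) ->
  grad (average f) z = n%:R^-1 *: \sum_(i < n) grad (f i) z.
Proof.
move=> df; apply/colP => k; rewrite !mxE summxE.
have -> : average f = n%:R^-1 \*: \sum_(i < n) f i.
  by apply/funext => x; rewrite /average fct_sumE.
rewrite deriveZ; last exact/diff_derivable/differentiable_sum.
rewrite derive_sum; last by move=> i; exact: diff_derivable.
by congr (_ * _); apply: eq_bigr => i _; rewrite mxE.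
Qed.

(** Strong convexity between 0 and a coordinate vector e, used in both
    directions, says that the partial derivative of the average along e grows
    by at least mu from 0 to e. It grows by at most L, because this partial
    derivative is the mean of those of the f_i, each of which grows by at most
    the norm of the increment of its gradient. *)
Lemma strong_convexity_le_lipschitz (R : realType) (d n : nat)
    (f : 'I_n -> 'cV[R]_d -> R) (mu L : R) :
  (0 < d)%N -> (0 < n)%N ->
  (forall i z, differentiable (f i) z) -> strongly_convex mu (average f) ->
  (forall i, lipschitz_gradient L (f i)) -> mu <= L.
Proof.
move=> d0 n0 df cf Lf; pose k := Ordinal d0.
pose e : 'cV[R]_d := delta_mx k 0.
have dote v : dotp v e = v k 0.
  rewrite /dotp (bigD1 k) //= big1 => [|j jk]; rewrite !mxE ?eqxx ?mulr1 ?addr0 //.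
  by rewrite (negbTE jk) mulr0.
have norm_e : norm2 e = 1 by rewrite /norm2 dote mxE !eqxx sqrtr1.
have dotN (v : 'cV[R]_d) : dotp v (- e) = - v k 0.
  by rewrite -dote /dotp -sumrN; apply: eq_bigr => i _; rewrite mxE mulrN.
have norm_Ne : norm2 (- e) = 1.
  by rewrite /norm2 dotN mxE opprK mxE !eqxx sqrtr1.
have := cf 0 e; have := cf e 0.
rewrite subr0 sub0r dote dotN norm_e norm_Ne expr1n mulr1 => c1 c2.
apply: (@le_trans _ _ ((grad (average f) e - grad (average f) 0) k 0)).
  by rewrite [leRHS]mxE [X in _ + X]mxE; lra.
rewrite !grad_average // -scalerBr -sumrB mxE summxE.
rewrite ler_pdivrMl ?ltr0n // mulr_natl -[X in L *+ X]card_ord -sumr_const.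
apply: ler_sum => i _.
apply: le_trans (ler_entry_norm2 _ _) _.
by apply: le_trans (Lf i _ _) _; rewrite subr0 norm_e mulr1.
Qed.

(** * The common bound *)

(** Write t = r - b. As e p <= s e, the assumption on r gives
    t > s (5/2 e + h) and t - e p > s (3/2 e + h), so that t (t - e p) exceeds
    p (15/4 e^2 + 4 e h + h^2). Subtracting e' p (2 + p) <= 3 p e^2 still leaves
    more than p h^2, which is where the constant 5/2 comes from: it makes
    5/2 * 3/2 >= 3. *)
Lemma cubic_separation (R : realFieldType) (p m b e e' s h r : R) :
  0 < m -> p <= 1 -> 0 <= e -> 0 <= e' -> e' <= e ^+ 2 ->
  0 <= s -> s ^+ 2 = p -> 0 <= h -> m * h ^+ 2 = 2 * (p * e') ->
  1 - m / 2 < r -> b + s * (5 / 2 * e + h) < r ->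
  e' * p ^+ 3 <
    (r - (1 - m)) * ((r - b) * (r - (b + e * p)) - e' * (p * (2 + p))).
Proof.
move=> m0 p1 e0 e'0 ee s0 sp h0 mh r1 rb.
have s1 : s <= 1 by rewrite -(@expr_le1 _ 2) // sp.
set t := r - b; have -> : r - (b + e * p) = t - e * p by rewrite /t; lra.
have st : s * (5 / 2 * e + h) < t by rewrite /t; lra.
have eh0 : 0 <= 5 / 2 * e + h by lra.
have p0 : 0 <= p by rewrite -sp sqr_ge0.
have eps : e * p <= s * e by rewrite mulrC ler_wpM2r // -sp expr2 ler_piMl.
have T0 : 0 <= s * (5 / 2 * e + h) by rewrite mulr_ge0.
have T'0 : 0 <= s * (3 / 2 * e + h) by rewrite mulr_ge0 //; lra.
have : s * (5 / 2 * e + h) * (s * (3 / 2 * e + h)) < t * (t - e * p).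
  by apply: ltr_pM => //; lra.
rewrite (_ : s * _ * _ = p * (15 / 4 * e ^+ 2 + 4 * (e * h) + h ^+ 2));
  last by rewrite -sp; field.
move: (t * _) => q qT.
have eh : 0 <= p * (e * h) by rewrite !mulr_ge0.
have pe : e' * (p * (2 + p)) <= 3 * (p * e ^+ 2).
  rewrite (_ : e' * _ = (2 + p) * (p * e')); last by ring.
  apply: ler_pM; [lra|exact: mulr_ge0|lra|exact: ler_wpM2l].
have pe2 : 0 <= p * e ^+ 2 by rewrite mulr_ge0 ?sqr_ge0.
have : m / 2 * (p * h ^+ 2)
    < (r - (1 - m)) * (q - e' * (p * (2 + p))).
  by apply: ltr_pM; [lra|rewrite mulr_ge0 ?sqr_ge0|lra|lra].
apply: le_lt_trans.
rewrite (_ : m / 2 * _ = e' * p ^+ 2); last first.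
  by rewrite mulrCA mulrAC mh; field.
by rewrite ler_wpM2l // exprS ler_piMl ?sqr_ge0.
Qed.

(** The parameters e and e' allow one statement to cover the three matrices; e
    records how much the gradient increments are damped by the communication
    steps, and e' the product of this damping with that of the step along y. *)
Lemma spectral_radius_error_mx_le (R : realType)
    (p m b e e' s h u v x y : R) :
  0 < m -> m <= p -> p <= 1 -> 0 <= b -> 0 <= e -> 0 <= e' -> e' <= e ^+ 2 ->
  0 <= s -> s ^+ 2 = p -> 0 <= h -> m * h ^+ 2 = 2 * (p * e') ->
  0 <= u -> 0 <= v -> 0 <= x -> 0 <= y ->
  u * v * x = e' * p ^+ 3 -> v * y = e' * (p * (2 + p)) ->
  spectral_radius (mx_of_rows 3 3
    [:: [:: 1 - m; u; 0]; [:: 0; b; v]; [:: x; y; b + e * p]])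
  <= Num.max (1 - m / 2) (b + s * (5 / 2 * e + h)).
Proof.
move=> m0 mp p1 b0 e0 e'0 ee s0 sp h0 mh u0 v0 x0 y0 uvx vy.
have p0 : 0 <= p by lra.
apply: spectral_radius_cyclic_le => //; first lra.
- by rewrite addr_ge0 ?mulr_ge0.
- by rewrite le_max; apply/orP; left; lra.
move=> r; rewrite gt_max => /andP[r1 rb]; rewrite uvx vy; split; first lra.
  by apply: le_lt_trans rb; rewrite lerDl mulr_ge0 //; lra.
exact: cubic_separation rb.
Qed.

Theorem corollary8 (R : realType) (d n nc : nat) (E : rel 'I_n)
    (W : 'M[R]_n) (f : 'I_n -> 'cV[R]_d -> R) (mu L alpha : R)
    (hd : (0 < d)%N) (hnc : (1 <= nc)%N)
    (hf : forall (i : 'I_n) (z : 'cV[R]_d), differentiable (f i) z)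
    (hmu : 0 < mu)
    (hconvex : strongly_convex mu (average f))
    (hL : forall i : 'I_n, lipschitz_gradient L (f i))
    (hE : connected_network E)
    (hW : mixing_matrix E W)
    (hWJ : W <> averaging_mx R n)
    (halpha0 : 0 < alpha) (halphaL : alpha <= 1 / L) :
  let kappa := L / mu in
  let beta := mixing_rate W in
  [/\ spectral_radius (A1 n nc alpha L mu beta)
        <= Num.max (1 - alpha * mu / 2)
             (beta ^+ nc
                + Num.sqrt (alpha * L) * (5 / 2 + Num.sqrt (2 * kappa))),
      spectral_radius (A2 n nc alpha L mu beta)
        <= Num.max (1 - alpha * mu / 2)
             (beta ^+ nc
                + Num.sqrt (alpha * L)
                    * (5 / 2 + Num.sqrt (2 * kappa * beta ^+ nc)))
    & spectral_radius (A3 n nc alpha L mu beta)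
        <= Num.max (1 - alpha * mu / 2)
             (beta ^+ nc
                * (1 + Num.sqrt (alpha * L)
                         * (5 / 2 + Num.sqrt (2 * kappa))))].
Proof.
(* There is only one matrix of size 0, and it is the averaging matrix. *)
have n0 : (0 < n)%N.
  case: n E W f hf hconvex hL hE hW hWJ => // ? W _ _ _ _ _ _ [].
  by apply/matrixP => -[].
have L0 : 0 < L by rewrite -invr_gt0 -div1r; exact: lt_le_trans halphaL.
have muL : mu <= L by exact: strong_convexity_le_lipschitz hconvex hL.
have [_ dW _ _ _] := hW; move=> kappa beta.
have b0 : 0 <= beta ^+ nc by rewrite exprn_ge0 ?opnorm2_ge0.
have b1 : beta ^+ nc <= 1.
  by rewrite exprn_ile1 ?opnorm2_ge0 ?mixing_rate_le1.
rewrite /A1 /A2 /A3; move: (beta ^+ nc) b0 b1 => b b0 b1.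
have p1 : alpha * L <= 1 by rewrite -ler_pdivlMr.
have p0 : 0 <= alpha * L by rewrite ltW ?mulr_gt0.
have m0 : 0 < alpha * mu by rewrite mulr_gt0.
have mp : alpha * mu <= alpha * L by rewrite ler_pM2l.
have k0 : 0 <= 2 * kappa by rewrite mulr_ge0 // divr_ge0 // ltW.
have rn0 : 0 < Num.sqrt n%:R :> R by rewrite sqrtr_gt0 ltr0n.
have rn_neq0 : Num.sqrt n%:R != 0 :> R by rewrite gt_eqF.
have sp := sqr_sqrtr p0.
have mu_neq0 : mu != 0 by rewrite gt_eqF.
have pL0 : 0 <= L * (2 + alpha * L) by rewrite mulr_ge0 ?ltW //; lra.
have a_ge0 := ltW halpha0.
have u0 : 0 <= alpha * L / Num.sqrt n%:R by rewrite divr_ge0 // ltW.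
have x0 : 0 <= Num.sqrt n%:R * alpha * L ^+ 2.
  by rewrite !mulr_ge0 ?sqr_ge0 // ltW.
have mk (g : R) : 0 <= g ->
  alpha * mu * Num.sqrt (2 * kappa * g) ^+ 2 = 2 * (alpha * L * g).
  by move=> g0; rewrite sqr_sqrtr ?(mulr_ge0 k0) // /kappa; field.
split.
- have -> : b + alpha * L = b + 1 * (alpha * L) by rewrite mul1r.
  rewrite -[5 / 2]mulr1.
  apply: (@spectral_radius_error_mx_le _ (alpha * L) _ _ _ 1) => //.
  + by rewrite expr1n.
  + by rewrite -(mk 1) // mulr1.
  + by field.
  + by ring.
- have -> : b + alpha * L = b + 1 * (alpha * L) by rewrite mul1r.
  rewrite -[5 / 2]mulr1.
  apply: (@spectral_radius_error_mx_le _ (alpha * L) _ _ _ b) => //.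
  + by rewrite expr1n.
  + by rewrite mk.
  + by rewrite mulr_ge0.
  + by field.
  + by ring.
- rewrite (_ : b * (1 + alpha * L) = b + b * (alpha * L)); last by ring.
  rewrite (_ : b * (1 + _) = b + Num.sqrt (alpha * L)
    * (5 / 2 * b + Num.sqrt (2 * kappa) * b)); last by ring.
  apply: (@spectral_radius_error_mx_le _ (alpha * L) _ _ _ (b ^+ 2)) => //.
  + exact: sqr_ge0.
  + by rewrite mulr_ge0 ?sqrtr_ge0.
  + by rewrite exprMn [LHS]mulrA -[2 * kappa]mulr1 mk // mulr1; ring.
  + by rewrite mulr_ge0.
  + by rewrite !mulr_ge0 // ltW.
  + by rewrite -mulrA mulr_ge0.
  + by field.
  + by ring.
Qed.
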